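(* Consider linear $(n,k,d,r,\delta)$-LRCs over $\mathbb{F}_q$ with fixed locality $(r,\delta)$, in the asymptotic regime $n\to\infty$. Let $\mathcal{R}=k/n$ be the rate and $\delta_n=d/n$ the relative minimum distance, let $\kappa_B$ be the upper bound on the local dimension, and let $\nu=\mathcal{G}(\kappa_B,\delta)/\kappa_B$. Then, asymptotically as $n\to\infty$, $$\mathcal{R}\le\min_{0\le x<\frac{1}{\nu}}\; x+(1-x\nu)\,R_{\mathrm{opt}}\!\left(\frac{\delta_n}{1-x\nu}\right).$$
   Context: $[n]=\{1,\dots,n\}$. A linear $(n,k,d,r,\delta)$-LRC over $\mathbb{F}_q$ is a linear code $\mathcal{C}$ over $\mathbb{F}_q$ of length $n$, dimension $k$ and minimum distance $d$ with all-symbol locality $(r,\delta)$: for every $i\in[n]$ there is a set $R\subseteq[n]$, called a repair set, with $i\in R$, $|R|\le r+\delta-1$, and such that the restriction $\mathcal{C}|_R=\{\mathbf{c}_R:\mathbf{c}\in\mathcal{C}\}$ has minimum distance at least $\delta$. $\kappa_B$ denotes the value of an arbitrary upper bound on the maximal dimension of a repair set (that is, of the restricted code $\mathcal{C}|_R$), obtained as an upper bound on the dimension of a code over $\mathbb{F}_q$ given its length $r+\delta-1$ and its minimum distance $\delta$. $\mathcal{G}(k,d)=\sum_{i=0}^{k-1}\lceil d/q^i\rceil$ is the Griesmer bound over $\mathbb{F}_q$. $k_{\mathrm{opt}}^{(q)}(n,d)$ is the maximal dimension of a code over an alphabet of size $q$ of length $n$ and minimum distance $d$ (or an upper bound on this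 dimension), and $R_{\mathrm{opt}}(\delta_n)=\lim_{n\to\infty}\frac{k_{\mathrm{opt}}^{(q)}(n,\delta_n n)}{n}$. *)

(* Defs.v *)
From HB Require Import structures.
From mathcomp Require Import all_boot all_order all_algebra.
From mathcomp Require Import all_classical all_reals all_analysis.

Set Implicit Arguments.
Unset Strict Implicit.
Unset Printing Implicit Defensive.

Import Order.TTheory GRing.Theory Num.Theory.
Import numFieldNormedType.Exports.
Local Open Scope ring_scope.

(* A linear code of length n over F is a subspace of 'rV[F]_n; coordinates    *)
(* are indexed from 0.                                                        *)

Definition hamming_dist (F : finFieldType) (n : nat) (u v : 'rV[F]_n) : nat :=
  #|[pred i : 'I_n | u ord0 i != v ord0 i]|.

(* Holds vacuously for the zero code, whose minimum distance is thus treated  *)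
(* as infinite.                                                               *)
Definition min_dist_ge (F : finFieldType) (n : nat)
    (C : {vspace 'rV[F]_n}) (d : nat) : Prop :=
  forall u v, u \in C -> v \in C -> u != v -> (d <= hamming_dist u v)%N.

Definition has_min_dist (F : finFieldType) (n : nat)
    (C : {vspace 'rV[F]_n}) (d : nat) : Prop :=
  min_dist_ge C d /\
  exists u v, [/\ u \in C, v \in C, u != v & hamming_dist u v = d].

(* The restricted code has length #|A|: its coordinates are the elements of A *)
(* in increasing order.                                                       *)
Definition restrict_code (F : finFieldType) (n : nat)
    (C : {vspace 'rV[F]_n}) (A : {set 'I_n}) : {vspace 'rV[F]_#|A|} :=
  (linfun (fun c : 'rV[F]_n => \row_(j < #|A|) c ord0 (enum_val j)) @: C)%VS.

(* linfun is only meaningful on linear maps; this one is linear.              *)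
Lemma mem_restrict_code (F : finFieldType) (n : nat)
    (C : {vspace 'rV[F]_n}) (A : {set 'I_n}) (w : 'rV[F]_#|A|) :
  w \in restrict_code C A <->
  exists2 c, c \in C & w = \row_(j < #|A|) c ord0 (enum_val j).
Proof.
set f := fun c : 'rV[F]_n => \row_(j < #|A|) c ord0 (enum_val j).
have fL : linear f by move=> a u v; apply/rowP => j; rewrite !mxE.
pose fl : {linear 'rV[F]_n -> 'rV[F]_#|A|} :=
  HB.pack f (GRing.isLinear.Build _ _ _ _ f fL).
have fE c : linfun f c = f c by exact: (lfunE fl).
split=> [/memv_imgP[c cC ->]|[c cC ->]]; first by exists c; rewrite ?fE.
by rewrite -[X in X \in _]fE; apply: memv_img.
Qed.

(* All-symbol locality (r, delta): A is a repair set for the coordinate i.    *)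
Definition has_locality (F : finFieldType) (n : nat)
    (C : {vspace 'rV[F]_n}) (r delta : nat) : Prop :=
  forall i : 'I_n, exists A : {set 'I_n},
    [/\ i \in A, (#|A| <= r + delta - 1)%N
      & min_dist_ge (restrict_code C A) delta].

Definition is_LRC (F : finFieldType) (n k d r delta : nat)
    (C : {vspace 'rV[F]_n}) : Prop :=
  [/\ \dim C = k, has_min_dist C d & has_locality C r delta].

Definition local_dim_bound (F : finFieldType) (r delta kappa : nat) : Prop :=
  forall C : {vspace 'rV[F]_(r + delta - 1)},
    min_dist_ge C delta -> (\dim C <= kappa)%N.

Definition griesmer (R : realType) (q k d : nat) : R :=
  \sum_(i < k) (Num.ceil (d%:R / q%:R ^+ i : R))%:~R.

(* Any upper bound on the dimension of linear codes over F, hence in          *)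
(* particular the maximal dimension itself and any upper bound on log_q of    *)
(* the size of arbitrary, possibly nonlinear, codes over an alphabet of size  *)
(* q = #|F|.                                                                  *)
Definition kopt_bound (R : realType) (F : finFieldType)
    (kopt : nat -> nat -> R) : Prop :=
  forall (n d : nat) (C : {vspace 'rV[F]_n}),
    min_dist_ge C d -> (\dim C)%:R <= kopt n d.

(* Minimum distances are integers, so minimum distance y * n stands for       *)
(* minimum distance at least the ceiling of y * n.                            *)
Definition kopt_rate (R : realType) (kopt : nat -> nat -> R) (y : R)
    (n : nat) : R :=
  kopt n (absz (Num.ceil (y * n%:R))) / n%:R.

Definition Ropt (R : realType) (kopt : nat -> nat -> R) (y : R) : R :=
  limn (kopt_rate kopt y).

(* Main.v *)
Require Import Defs.
From HB Require Import structures.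
From mathcomp Require Import all_boot all_order all_algebra.
From mathcomp Require Import all_classical all_reals all_analysis.
From mathcomp Require Import ring lra zify.

(* If some nonzero word of C vanishes on a set U, then the repair set A of a  *)
(* coordinate where that word is nonzero raises the rank of U by some         *)
(* 1 <= rho <= kappa, and the words vanishing on U restrict on A \ U to a     *)
(* code of dimension rho and minimum distance at least delta; so A \ U has at *)
(* least G(rho, delta) >= nu rho elements by the Griesmer bound. Hence for    *)
(* every x there is a set U of rank at most x n, and within kappa of it       *)
(* unless C is exhausted, with at least nu times its rank elements.           *)
(* Shortening C on U leaves a code of length about (1 - x nu) n, distance at  *)
(* least d and dimension at least k - x n. Shortening or padding it further   *)
(* to a length N with y N <= d, where y = Delta / (1 - x nu) and              *)
(* N / n -> 1 - x nu, costs o(n) dimensions, and no continuity of R_opt is    *)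
(* needed.                                                                    *)

Set Implicit Arguments.
Unset Strict Implicit.
Unset Printing Implicit Defensive.

Import Order.TTheory GRing.Theory Num.Theory.
Import numFieldNormedType.Exports.
Local Open Scope ring_scope.
Local Open Scope classical_set_scope.

(** The rank of a set [U] of coordinates is [\dim C - \dim (shortened C U)]. By [griesmer_bound] and
    [griesmer_slope], a repair set can contribute at least [nu] new coordinates per unit of new rank
    ([repair_step]); [exists_dense_set] accumulates this, and [dim_LRC_le] turns it into an
    inequality at each finite length for each fixed [x]. Since the infimum is only needed up to
    [eps], one [x] within [eps / 2] of it is chosen before [m] grows, so no uniformity in [x] is
    required. *)

Section Codes.
(* classical_sets shadows set0, setIC, subsetP, etc. *)
Import mathcomp.boot.fintype mathcomp.boot.finset.
Variable F : finFieldType.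

(** * Supports, restriction and shortening *)

Definition supp n (c : 'rV[F]_n) : {set 'I_n} := [set i | c ord0 i != 0].

Definition keep n (A : {set 'I_n}) : 'End('rV[F]_n) :=
  linfun (mulmxr (diag_mx (\row_i (i \in A)%:R))).

Definition shortened n (C : {vspace 'rV[F]_n}) (A : {set 'I_n}) :=
  (C :&: lker (keep A))%VS.

Lemma keepE n (A : {set 'I_n}) (c : 'rV[F]_n) i :
  keep A c ord0 i = if i \in A then c ord0 i else 0.
Proof.
by rewrite lfunE /= mul_mx_diag !mxE; case: (i \in A); rewrite ?mulr1 ?mulr0.
Qed.

Lemma supp_keep n (A : {set 'I_n}) (c : 'rV[F]_n) :
  supp (keep A c) = A :&: supp c.
Proof.
by apply/setP => i; rewrite !inE keepE; case: (i \in A); rewrite ?eqxx.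
Qed.

Lemma supp_eq0 n (c : 'rV[F]_n) : (supp c == set0) = (c == 0).
Proof.
apply/eqP/eqP => [/setP c0|->]; last by apply/setP => i; rewrite !inE mxE eqxx.
by apply/rowP => i; have := c0 i; rewrite !inE mxE => /negbFE/eqP.
Qed.

Lemma mem_shortened n (C : {vspace 'rV[F]_n}) A c :
  (c \in shortened C A) = (c \in C) && [disjoint A & supp c].
Proof.
by rewrite memv_cap memv_ker -supp_eq0 supp_keep setI_eq0.
Qed.

Lemma hamming_distE n (u v : 'rV[F]_n) : hamming_dist u v = #|supp (u - v)|.
Proof. by apply: eq_card => i; rewrite !inE !mxE subr_eq0. Qed.

Lemma min_dist_geP n (C : {vspace 'rV[F]_n}) d :
  min_dist_ge C d <-> forall c, c \in C -> c != 0 -> (d <= #|supp c|)%N.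
Proof.
split=> [h c cC c0|h u v uC vC uv].
  by have := h c 0 cC (mem0v _) c0; rewrite hamming_distE subr0.
by rewrite hamming_distE h ?rpredB ?subr_eq0.
Qed.

(** Listing [S] in the first positions of a word of length [N] preserves weights. This carries codes
    supported on [S] to the true length that [kappaP] and [koptP] speak about. *)
Lemma supported_embedding n N (D : {vspace 'rV[F]_n}) (S : {set 'I_n}) d :
    (forall c, c \in D -> supp c \subset S) -> (#|S| <= N)%N ->
    min_dist_ge D d ->
  exists2 D' : {vspace 'rV[F]_N}, min_dist_ge D' d & \dim D' = \dim D.
Proof.
move=> DS SN /min_dist_geP Dd.
pose P : 'M[F]_(n, N) :=
  \matrix_(i, j) ((i \in S) && (index i (enum S) == j))%:R.
pose f : 'Hom('rV[F]_n, 'rV[F]_N) := linfun (mulmxr P).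
have le_supp c : c \in D -> (#|supp c| <= #|supp (f c)|)%N.
  move=> cD; have [->|[i0 _]] := set_0Vmem (supp c); first by rewrite cards0.
  (* [g] undoes the reindexing, so the support of [c] lies in the image under [g] of the support of
     [f c]. *)
  pose g (j : 'I_N) := nth i0 (enum S) j.
  apply: leq_trans (leq_imset_card g _); apply/subset_leq_card/subsetP => i ic.
  have iS : i \in S by apply: (subsetP (DS c cD)).
  have iN : (index i (enum S) < N)%N.
    by apply: leq_trans SN; rewrite cardE index_mem mem_enum.
  apply/imsetP; exists (Ordinal iN); last by rewrite /g nth_index // mem_enum.
  rewrite inE lfunE /= mxE (bigD1 i) //= !mxE iS eqxx mulr1 big1 ?addr0.
    by move: ic; rewrite inE.
  move=> i' ne; rewrite !mxE; case: (boolP (i' \in S)) => [i'S|]; last first.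
    by rewrite mulr0.
  case: eqP => [e|_]; last by rewrite mulr0.
  case/eqP: ne; rewrite -(nth_index i0 (_ : i' \in enum S)) ?mem_enum //.
  by rewrite e nth_index // mem_enum.
have f0 c : c \in D -> f c = 0 -> c = 0.
  move=> cD fc; apply/eqP; rewrite -supp_eq0 -cards_eq0 -leqn0.
  apply: leq_trans (le_supp c cD) _; rewrite fc leqn0 cards_eq0.
  by rewrite supp_eq0.
exists (f @: D)%VS.
  apply/min_dist_geP => _ /memv_imgP[c cD ->] fc0.
  apply: leq_trans (le_supp c cD); apply: Dd => //.
  by apply: contraNneq fc0 => ->; rewrite linear0.
apply: limg_dim_eq; apply/eqP; rewrite -subv0; apply/subvP => c.
rewrite memv_cap memv_ker => /andP[cD /eqP fc].
by rewrite (f0 c cD fc) mem0v.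
Qed.

Lemma dim_keep_img n (D : {vspace 'rV[F]_n}) A :
  (\dim (keep A @: D) <= #|A|)%N.
Proof.
have [|//||D' _ <-] := @supported_embedding n #|A| (keep A @: D)%VS A 0.
- by move=> _ /memv_imgP[c _ ->]; rewrite supp_keep subsetIl.
- by move=> ? ?.
by apply: leq_trans (dimvS (subvf _)) _; rewrite dimvf /dim /= mul1n.
Qed.

Lemma dim_shortened n (D : {vspace 'rV[F]_n}) A :
  (\dim (shortened D A) + \dim (keep A @: D))%N = \dim D.
Proof. exact: limg_ker_dim. Qed.

(** Shortening on the surplus coordinates costs at most one dimension each; if [S] fits into length
    [N], the truncated difference is 0 and zeros are padded. *)
Lemma shorten_pad n N (D : {vspace 'rV[F]_n}) (S : {set 'I_n}) d :
    (forall c, c \in D -> supp c \subset S) -> min_dist_ge D d ->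
  exists2 D' : {vspace 'rV[F]_N}, min_dist_ge D' d
    & (\dim D <= (#|S| - N) + \dim D')%N.
Proof.
move=> DS Dd.
have [T TS cT] : exists2 T : {set 'I_n}, T \subset S & #|T| = (#|S| - N)%N.
  have [s [us ss sS]] : exists s : seq 'I_n,
      [/\ uniq s, size s = (#|S| - N)%N & {subset s <= enum S}].
    exists (take (#|S| - N) (enum S)); rewrite take_uniq ?enum_uniq //.
    rewrite size_take -cardE; split=> //; last exact: mem_take.
    by case: ltnP => // h; apply/eqP; rewrite eqn_leq h leq_subr.
  exists [set i in s].
    by apply/subsetP => i; rewrite inE => /sS; rewrite mem_enum.
  by rewrite cardsE -ss; apply/card_uniqP.
have [c||| D' D'd dD'] := @supported_embedding n N (shortened D T) (S :\: T) d.
- rewrite mem_shortened finset.subsetD disjoint_sym => /andP[/DS -> ->] //.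
- rewrite cardsD (setIidPr TS) cT; lia.
- by move=> u v; rewrite !memv_cap => /andP[uD _] /andP[vD _]; apply: Dd.
exists D' => //; rewrite dD' -(dim_shortened D T) addnC leq_add2r.
by rewrite -cT dim_keep_img.
Qed.

(* Passing to the residual code with respect to a word of minimum weight      *)
(* divides the minimum distance by q; a real d avoids nested ceilings.        *)
Lemma griesmer_bound (R : realType) n (D : {vspace 'rV[F]_n}) (S : {set 'I_n})
    (d : R) :
    (forall c, c \in D -> supp c \subset S) ->
    (forall c, c \in D -> c != 0 -> d <= #|supp c|%:R) ->
  \sum_(i < \dim D) (Num.ceil (d / #|F|%:R ^+ i))%:~R <= #|S|%:R :> R.
Proof.
have q0 : (0 < #|F|)%N by apply/card_gt0P; exists 0.
move: {2}(\dim D) (erefl (\dim D)) => k dD.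
elim: k D S d dD => [|k IH] D S d dD DS Dd; first by rewrite dD big_ord0.
pose P c := (c \in D) && (c != 0).
have P0 : P (vpick D) by rewrite /P memv_pick vpick0 -dimv_eq0 dD.
case: (@arg_minnP _ (vpick D) P (fun c => #|supp c|) P0) => c /andP[cD c0] cmin.
pose f := keep (~: supp c).
have fc : f c = 0 by apply/eqP; rewrite -supp_eq0 supp_keep setIC setICr.
have kerf : (D :&: lker f = <[c]>)%VS.
  apply/eqP; rewrite eqEsubv; apply/andP; split; last first.
    by rewrite -memvE memv_cap cD memv_ker fc /=.
  apply/subvP => u; rewrite memv_cap memv_ker -supp_eq0 supp_keep.
  rewrite setIC setI_eq0 disjoints_subset setCK => /andP[uD /subsetP us].
  have /set0Pn[i ic] : supp c != set0 by rewrite supp_eq0.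
  (* A word [u] of [D] supported inside [supp c] is a multiple of [c]: cancelling coordinate [i]
     leaves a word of weight below the minimum, hence 0. *)
  pose a := u ord0 i / c ord0 i.
  suff : u - a *: c = 0.
    by move/eqP; rewrite subr_eq0 => /eqP ->; rewrite memvZ ?memv_line.
  apply/eqP/negbNE/negP => u0.
  have : (#|supp c| <= #|supp (u - a *: c)|)%N.
    by apply: cmin; rewrite /P u0 andbT rpredB ?rpredZ.
  rewrite leqNgt; case/negP; apply: proper_card; apply/properP; split.
    apply/subsetP => j; rewrite inE !mxE; apply: contraR => jc.
    have : j \notin supp u by apply: contra jc; apply: us.
    move: jc; rewrite !inE !negbK => /eqP -> /eqP ->.
    by rewrite mulr0 subr0.
  exists i => //; rewrite inE !mxE negbK /a divfK ?subrr //.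
  by move: ic; rewrite inE.
have dD' : \dim (f @: D) = k.
  by have := limg_ker_dim f D; rewrite kerf dim_vline c0 dD; case.
have D'S v : v \in (f @: D)%VS -> supp v \subset S :\: supp c.
  case/memv_imgP => u uD ->; rewrite supp_keep setDE setIC.
  by apply: setSI; apply: DS.
have D'd v : v \in (f @: D)%VS -> v != 0 -> d / #|F|%:R <= #|supp v|%:R.
  case/memv_imgP => u uD -> fu0; rewrite ler_pdivrMr ?ltr0n //.
  apply: le_trans (Dd c cD c0) _; rewrite -natrM ler_nat.
  have h a : (#|supp c| <= #|supp (u - a *: c)|)%N.
    apply: cmin; rewrite /P rpredB ?rpredZ //=.
    apply: contraNneq fu0 => /eqP; rewrite subr_eq0 => /eqP ->.
    by rewrite linearZ /= fc scaler0.
  (* Average the weight of [u - a *: c] over all scalars [a]. A coordinate in [supp c] vanishes for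
     one [a]; any other counts for all [a] or for none. With [w] and [w'] the weights of [c] and
     [f u], this gives [q w <= q w' + (q - 1) w], so [w <= q w']. *)
  have : (\sum_(a : F) #|supp c| <= \sum_(a : F) #|supp (u - a *: c)|)%N.
    by apply: leq_sum => a _; apply: h.
  rewrite sum_nat_const.
  have -> : (\sum_(a : F) #|supp (u - a *: c)| =
      \sum_(i : 'I_n) #|[set a : F | (u - a *: c)%R ord0 i != 0%R]|)%N.
    under eq_bigr do rewrite -sum1_card.
    under [RHS]eq_bigr do rewrite -sum1_card.
    rewrite (exchange_big_dep xpredT) //=; apply: eq_bigr => i _.
    by apply: eq_bigl => a; rewrite !inE.
  have le_i (i : 'I_n) : (#|[set a : F | (u - a *: c)%R ord0 i != 0%R]| <=
      (i \in supp (f u)) * #|F| + (i \in supp c) * #|F|.-1)%N.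
    rewrite supp_keep !inE; case: (eqVneq (c ord0 i) 0) => ci /=.
      rewrite mul0n addn0; case: (eqVneq (u ord0 i) 0) => ui /=.
        rewrite leqn0 cards_eq0; apply/eqP/setP => a.
        by rewrite !inE !mxE ci ui mulr0 subr0 eqxx.
      by rewrite mul1n max_card.
    rewrite mul1n -(leq_add2l 1) addSn add1n prednK //.
    apply: leq_trans (_ : (#|[set~ (u ord0 i / c ord0 i)]|.+1 <= _)%N).
      rewrite ltnS; apply/subset_leq_card/subsetP => a.
      rewrite !inE !mxE; apply: contraNneq => ->.
      by rewrite divfK // subrr.
    by rewrite cardsC1 prednK.
  move/leq_trans/(_ (leq_sum _ (fun i _ => le_i i))).
  have cardE (X : {set 'I_n}) : (\sum_(i < n) (i \in X) = #|X|)%N.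
    by rewrite -sum1_card [RHS]big_mkcond; apply: eq_bigr => i _; case: ifP.
  rewrite big_split /= -!big_distrl /= !cardE.
  by move: #|supp c| #|supp (f u)| #|F| q0 => x y q q0' hq; nia.
rewrite dD big_ord_recl expr0 divr1 /=.
have -> : #|S|%:R = #|supp c|%:R + #|S :\: supp c|%:R :> R.
  by rewrite -natrD -(cardsID (supp c) S) (setIidPr (DS c cD)).
apply: lerD.
  by rewrite pmulrn ler_int ceil_le_int -pmulrn Dd.
have := IH _ _ _ dD' D'S D'd; rewrite dD'; apply: le_trans.
rewrite le_eqVlt; apply/orP; left; apply/eqP; apply: eq_bigr => i _.
by rewrite /bump /= exprS invfM mulrA.
Qed.

End Codes.
Arguments keep {F n} A.

(** * Repair sets and coordinate sets with many elements per unit of rank *)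

Section LRC.
Import mathcomp.boot.fintype mathcomp.boot.finset.
Variables (R : realType) (F : finFieldType).

(** The mean of an initial segment of an antitone sequence decreases with its length;
    cross-multiplying avoids dividing by zero. *)
Lemma antitone_mean_le (t : nat -> R) (m n : nat) :
    (forall i j, (i <= j)%N -> t j <= t i) -> (m <= n)%N ->
  m%:R * \sum_(i < n) t i <= n%:R * \sum_(i < m) t i.
Proof.
move=> tP; elim: n => [|n IH]; first by rewrite leqn0 => /eqP ->.
rewrite leq_eqVlt => /predU1P[->//|]; rewrite ltnS => mn.
rewrite big_ord_recr /= mulrDr -natr1 mulrDl mul1r lerD ?IH //.
rewrite mulr_natl -{1}(card_ord m) -sumr_const; apply: ler_sum => i _.
by apply/tP/ltnW/(leq_trans _ mn).
Qed.

Lemma antitone_griesmer_term (delta i j : nat) : (i <= j)%N ->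
  (Num.ceil (delta%:R / #|F|%:R ^+ j : R))%:~R <=
  (Num.ceil (delta%:R / #|F|%:R ^+ i : R))%:~R :> R.
Proof.
move=> ij; have q1 : (1 <= #|F|%:R :> R).
  by rewrite ler1n; apply/card_gt0P; exists 0.
rewrite ler_int; apply: le_ceil; apply: ler_wpM2l => //.
rewrite lef_pV2 ?posrE ?exprn_gt0 ?(lt_le_trans ltr01) //.
exact: ler_weXn2l.
Qed.

Lemma griesmer_ge0 (k delta : nat) : 0 <= griesmer R #|F| k delta.
Proof.
apply: sumr_ge0 => i _; rewrite ler0z ceil_ge0.
by apply: lt_le_trans (_ : 0 <= _); rewrite ?ltrN10 ?divr_ge0 ?exprn_ge0.
Qed.

Lemma griesmer_gt0 (k delta : nat) :
  (0 < k)%N -> (0 < delta)%N -> 0 < griesmer R #|F| k delta.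
Proof.
case: k => // k _ delta0; rewrite /griesmer big_ord_recl expr0 divr1.
apply: ltr_wpDr; last by rewrite ltr0z ceil_gt0 ltr0n.
apply: sumr_ge0 => i _; rewrite ler0z ceil_ge0.
by apply: lt_le_trans (_ : 0 <= _); rewrite ?ltrN10 ?divr_ge0 ?exprn_ge0.
Qed.

Lemma griesmer_slope (rho kappa delta : nat) : (rho <= kappa)%N ->
  griesmer R #|F| kappa delta / kappa%:R * rho%:R
  <= griesmer R #|F| rho delta.
Proof.
move=> rk; have [->|k0] := posnP kappa.
  by rewrite invr0 mulr0 mul0r griesmer_ge0.
rewrite mulrAC ler_pdivrMr ?ltr0n // mulrC [leRHS]mulrC.
exact: (antitone_mean_le (@antitone_griesmer_term delta)).
Qed.

Variables (n r delta kappa : nat) (C : {vspace 'rV[F]_n}).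
Hypothesis locC : has_locality C r delta.
Hypothesis kappaP : local_dim_bound F r delta kappa.

Lemma repair_set (i : 'I_n) : exists A : {set 'I_n},
  [/\ i \in A, (#|A| <= r + delta - 1)%N &
    forall c, c \in C -> keep A c != 0 -> (delta <= #|supp (keep A c)|)%N].
Proof.
have [A [iA sA /min_dist_geP h]] := locC i; exists A; split=> // c cC kc0.
pose w : 'rV[F]_#|A| := \row_j c ord0 (enum_val j).
have /h : w \in restrict_code C A by apply/mem_restrict_code; exists c.
have w0 : w != 0.
  apply: contraNneq kc0 => w0; apply/eqP/rowP => j; rewrite keepE mxE.
  case: ifP => // jA; have /rowP/(_ (enum_rank_in jA j)) := w0.
  by rewrite !mxE enum_rankK_in.
move=> /(_ w0) /leq_trans; apply.
rewrite -(card_imset _ (@enum_val_inj _ A)).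
apply/subset_leq_card/subsetP => _ /imsetP[j jw ->].
by move: jw; rewrite supp_keep !inE mxE enum_valP.
Qed.

Lemma shortenedU U A : shortened C (U :|: A) = shortened (shortened C U) A.
Proof.
apply/vspaceP => c; rewrite !mem_shortened -!setI_eq0 setIUl setU_eq0.
by rewrite andbA.
Qed.

Lemma repair_step (U : {set 'I_n}) : shortened C U != 0%VS ->
  exists (A : {set 'I_n}) (rho : nat),
    [/\ \dim (shortened C U) = (\dim (shortened C (U :|: A)) + rho)%N,
        (0 < rho <= kappa)%N &
        griesmer R #|F| rho delta <= #|A :\: U|%:R].
Proof.
rewrite -vpick0 => c0; set c := vpick _ in c0.
have cU : c \in shortened C U by apply: memv_pick.
have /set0Pn[i] : supp c != set0 by rewrite supp_eq0.
rewrite inE => ci; have [A [iA sA hA]] := repair_set i.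
pose D := (keep A @: shortened C U)%VS.
have DS v : v \in D -> supp v \subset A :\: U.
  case/memv_imgP => u; rewrite mem_shortened => /andP[_ Uu] ->.
  by rewrite supp_keep setDE setIS // -disjoints_subset disjoint_sym.
have Dd v : v \in D -> v != 0 -> (delta <= #|supp v|)%N.
  case/memv_imgP => u; rewrite mem_shortened => /andP[uC _] ->.
  exact: hA.
exists A, (\dim D); split; first by rewrite shortenedU dim_shortened.
  apply/andP; split.
    (* The rank grows because [c] vanishes on [U] but not at [i], which lies in [A]. *)
    rewrite lt0n dimv_eq0; apply: contraNneq ci => D0.
    have : keep A c \in D by apply: memv_img.
    by rewrite D0 memv0 => /eqP/rowP/(_ i); rewrite keepE iA mxE => ->.
  have [|||D' D'd <-] :=
    @supported_embedding F n (r + delta - 1) D A delta.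
  - by move=> v /DS /subset_trans; apply; rewrite subsetDl.
  - by [].
  - exact/min_dist_geP.
  exact: kappaP.
by apply: griesmer_bound DS _ => v vD v0; rewrite ler_nat Dd.
Qed.

Let nu : R := griesmer R #|F| kappa delta / kappa%:R.

(* A set U of maximal rank stands in for the greedy chain of repair sets.     *)
Lemma exists_dense_set (t : nat) : exists (U : {set 'I_n}) (lambda : nat),
  [/\ \dim C = (\dim (shortened C U) + lambda)%N, (lambda <= t)%N,
      nu * lambda%:R <= #|U|%:R &
      shortened C U = 0%VS \/ (t < lambda + kappa)%N].
Proof.
pose lam U := (\dim C - \dim (shortened C U))%N.
have lamE U : \dim C = (\dim (shortened C U) + lam U)%N.
  by rewrite /lam subnKC // dimvS // capvSl.
pose P U := (lam U <= t)%N && (nu * (lam U)%:R <= #|U|%:R).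
have lam0 : lam set0 = 0%N.
  rewrite /lam (_ : shortened C set0 = C) ?subnn //.
  by apply/vspaceP => c; rewrite mem_shortened -setI_eq0 set0I eqxx andbT.
have P0 : P set0 by rewrite /P lam0 mulr0 ler0n.
have [U /andP[Ut Unu] Umax] := @arg_maxnP _ set0 P lam P0.
exists U, (lam U); split=> //.
have [->|sU] := eqVneq (shortened C U) 0%VS; [by left|right].
have [A [rho [dU /andP[rho0 rhok] gA]]] := repair_step sU.
have lamA : lam (U :|: A) = (lam U + rho)%N.
  by have := lamE U; have := lamE (U :|: A); rewrite dU; lia.
(* If the rank were at most [t - kappa], adjoining [A] would keep it within [t] and raise it,
   against maximality. *)
rewrite ltnNge; apply/negP => lt; have : P (U :|: A).
  rewrite /P lamA; apply/andP; split; first by lia.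
  rewrite natrD mulrDr (_ : #|U :|: A| = #|U| + #|A :\: U|)%N; last first.
    by rewrite cardsU setIC cardsD addnBA ?subset_leq_card ?subsetIl.
  by rewrite natrD lerD // (le_trans _ gA) // griesmer_slope.
by move/Umax; rewrite lamA; lia.
Qed.

End LRC.

(** * The dimension bound at finite length *)

Section Bound.
Import mathcomp.boot.fintype mathcomp.boot.finset.
Variables (R : realType) (F : finFieldType) (kopt : nat -> nat -> R).
Hypothesis koptP : kopt_bound F kopt.

Lemma kopt_ge0 N d : 0 <= kopt N d.
Proof.
have := @koptP N d 0%VS; rewrite dimv0; apply=> u v.
by rewrite !memv0 => /eqP -> /eqP ->; rewrite eqxx.
Qed.

Lemma local_bound_gt0 n r delta kappa (C : {vspace 'rV[F]_n}) :
    has_locality C r delta -> local_dim_bound F r delta kappa ->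
  C != 0%VS -> (0 < kappa)%N.
Proof.
move=> locC kappaP C0.
have C1 : shortened C set0 = C.
  by apply/vspaceP => c; rewrite mem_shortened -setI_eq0 set0I eqxx andbT.
have [|A [rho [_ /andP[rho0 rhok] _]]] :=
  @repair_step R F _ _ _ _ _ locC kappaP set0.
  by rewrite C1.
exact: leq_trans rhok.
Qed.

(** The length left after shortening is at most [n (1 - x nu) + nu kappa], the last term because the
    rank of [U] may fall short of [x n] by up to [kappa]. The absolute value pays for moving to an
    arbitrary length [N]. *)
Lemma dim_LRC_le n r delta kappa d N e (x : R) (C : {vspace 'rV[F]_n})
    (nu := griesmer R #|F| kappa delta / kappa%:R : R) :
    has_locality C r delta -> local_dim_bound F r delta kappa ->
    min_dist_ge C d -> 0 <= x -> (e <= d)%N ->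
  (\dim C)%:R <=
    x * n%:R + `|n%:R * (1 - x * nu) + nu * kappa%:R - N%:R| + kopt N e.
Proof.
move=> locC kappaP Cd x0 ed.
have xn0 : 0 <= x * n%:R by rewrite mulr_ge0.
have nu0 : 0 <= nu by rewrite divr_ge0 ?griesmer_ge0.
have [U [lam [dC lamt nuU sU]]] :=
  exists_dense_set R locC kappaP (Num.truncn (x * n%:R)).
have lamx : lam%:R <= x * n%:R.
  by rewrite -truncn_ge_nat.
case: sU => [U0|lamk].
  rewrite dC U0 dimv0 add0n -addrA (le_trans lamx) // lerDl.
  by rewrite addr_ge0 ?kopt_ge0.
have lamx' : x * n%:R <= lam%:R + kappa%:R.
  by rewrite -natrD (le_trans (ltW (truncnS_gt _))) // ler_nat.
have [c||D' D'd dD'] := @shorten_pad F n N (shortened C U) (~: U) e.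
- by rewrite mem_shortened disjoint_sym disjoints_subset => /andP[].
- move=> u v; rewrite !memv_cap => /andP[uC _] /andP[vC _] uv.
  exact/(leq_trans ed)/Cd.
have := koptP D'd; set K := kopt N e => D'K.
have cU : #|~: U|%:R = n%:R - #|U|%:R :> R.
  by rewrite -[in n%:R](card_ord n) -(cardsC U) natrD addrC addKr.
have sub : (#|~: U| - N)%:R <=
    `|n%:R * (1 - x * nu) + nu * kappa%:R - N%:R| :> R.
  case: (leqP #|~: U| N) => [|/ltnW] h.
    by rewrite (eqP h) normr_ge0.
  rewrite natrB // cU; apply: le_trans (ler_norm _); rewrite lerB //.
  have := ler_wpM2l nu0 lamx'; move: nuU; rewrite -/nu => nuU.
  by clearbody nu; lra.
have dC' : (\dim C <= lam + (#|~: U| - N) + \dim D')%N.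
  by rewrite dC addnC -addnA leq_add2l.
apply: le_trans (_ : (lam + (#|~: U| - N) + \dim D')%N%:R <= _).
  by rewrite ler_nat.
by rewrite !natrD !lerD.
Qed.

End Bound.

(** * Limits of ratios of lengths *)

Section Asymptotics.
Variable R : realType.

(** Truncation changes the ratio by at most [1 / n_ m], which tends to 0. *)
Lemma cvg_truncn_ratio (a : nat -> R) (n_ : nat -> nat) (l : R) :
    (forall m, 0 <= a m) -> n_ m @[m --> \oo] --> \oo ->
    a m / (n_ m)%:R @[m --> \oo] --> l ->
  (Num.truncn (a m))%:R / (n_ m)%:R @[m --> \oo] --> l.
Proof.
move=> a0 noo al.
have inv0 : ((n_ m)%:R^-1 : R) @[m --> \oo] --> (0 : R).
  apply/gtr0_cvgV0; last by apply/cvgrnyP.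
  by have /cvgnyPge/(_ 1%N) := noo; apply: filterS => m h; rewrite ltr0n.
apply: (squeeze_cvgr (f := fun m => a m / (n_ m)%:R - (n_ m)%:R^-1) _ _ al).
  near=> m; have /andP[h1 h2] := truncn_itv (a0 m).
  rewrite -[X in _ - X]mul1r -mulrBl !ler_wpM2r ?invr_ge0 //=.
  by rewrite lerBlDr natr1 ltW.
by rewrite -[l]subr0; apply: cvgB.
Unshelve. all: by end_near. Qed.

Lemma ratio_cvg_infty (N_ n_ : nat -> nat) (l : R) :
    0 < l -> n_ m @[m --> \oo] --> \oo ->
    (N_ m)%:R / (n_ m)%:R @[m --> \oo] --> l ->
  N_ m @[m --> \oo] --> \oo.
Proof.
move=> l0 noo Nl; apply/(@cvgrnyP R)/cvgryPge => A.
have /(@cvgrnyP R)/cvgryPge nR := noo.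
near=> m.
have n0 : 0 < (n_ m)%:R :> R.
  by apply: lt_le_trans (_ : 1 <= _); [|near: m; exact: nR].
have : l / 2 <= (N_ m)%:R / (n_ m)%:R.
  by near: m; apply: (cvgr_ge l) => //; lra.
rewrite ler_pdivlMr //; apply: le_trans.
rewrite mulrC -ler_pdivrMr; last by lra.
by near: m; exact: nR.
Unshelve. all: by end_near. Qed.

End Asymptotics.

(** * Passage to the limit *)

Theorem mainTheorem7 (R : realType) (F : finFieldType)
  (r delta kappa : nat) (r_gt0 : (0 < r)%N) (delta_gt0 : (0 < delta)%N)
  (kappaP : local_dim_bound F r delta kappa)
  (kopt : nat -> nat -> R) (koptP : kopt_bound F kopt)
  (Ropt_exists : forall y : R, 0 <= y -> cvgn (kopt_rate kopt y))
  (n_ k_ d_ : nat -> nat) (C_ : forall m : nat, {vspace 'rV[F]_(n_ m)})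
  (LRC_C : forall m : nat, is_LRC (k_ m) (d_ m) r delta (C_ m))
  (n_to_oo : n_ m @[m --> \oo] --> \oo)
  (Delta : R) (d_rate : (d_ m)%:R / (n_ m)%:R @[m --> \oo] --> Delta) :
  let nu : R := griesmer R #|F| kappa delta / kappa%:R in
  forall eps : R, 0 < eps ->
    \forall m \near \oo,
      (k_ m)%:R / (n_ m)%:R <=
        inf [set x + (1 - x * nu) * Ropt kopt (Delta / (1 - x * nu))
            | x in [set x : R | 0 <= x < 1 / nu]] + eps.
Proof.
move=> nu eps eps0.
(* Having a minimum distance forces two distinct codewords, so the code is nonzero and [repair_step]
   yields a local rank between 1 and [kappa]. *)
have kappa0 : (0 < kappa)%N.
  have [_ [_ [u [v [uC vC uv _]]]] loc] := LRC_C 0%N.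
  apply: (@local_bound_gt0 R F _ _ _ _ _ loc kappaP).
  apply: contraNneq uv => C0; move: uC vC; rewrite C0 !memv0.
  by move=> /eqP -> /eqP ->.
have nu0 : 0 < nu by rewrite divr_gt0 ?griesmer_gt0 ?ltr0n.
have Delta0 : 0 <= Delta.
  by apply: (cvgr_to_ge d_rate); near=> m; rewrite divr_ge0.
have noo : ((n_ m)%:R : R) @[m --> \oo] --> +oo by apply/cvgrnyP.
have n_gt0 : \forall m \near \oo, 0 < (n_ m)%:R :> R.
  by have /cvgnyPge/(_ 1%N) := n_to_oo; apply: filterS => m h; rewrite ltr0n.
have inv0 : ((n_ m)%:R^-1 : R) @[m --> \oo] --> (0 : R) by apply/gtr0_cvgV0.
have Ropt_ge0 y : 0 <= y -> 0 <= Ropt kopt y.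
  move=> y0; apply: limr_ge; first exact: Ropt_exists.
  by near=> m; rewrite divr_ge0 // (kopt_ge0 koptP).
set S := [set _ | x in _].
have dom x : 0 <= x < 1 / nu -> 0 <= x /\ 0 < 1 - x * nu.
  by case/andP => x0; rewrite ltr_pdivlMr // subr_gt0.
have S_ge0 : lbound S 0.
  move=> _ [x /= /dom[x0 l0] <-].
  apply: addr_ge0 => //; apply: mulr_ge0; first exact: ltW.
  by apply: Ropt_ge0; rewrite divr_ge0 // ltW.
have S_inf : has_inf S.
  split; last by exists 0.
  by eexists; exists 0; [rewrite /= lexx divr_gt0|reflexivity].
have eps2 : 0 < eps / 2 by rewrite divr_gt0.
have [_ [x xS <-] xinf] := inf_adherent eps2 S_inf.
have [x0 l0] := dom _ xS; set l := 1 - x * nu in l0 xinf *.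
set y := Delta / l in xinf *.
have y0 : 0 <= y by rewrite divr_ge0 // ltW.
(* y * N_ m must not exceed d_ m although d_ m / n_ m may lie below Delta:    *)
(* hence N_ is defined from d_ m, unless y = 0.                               *)
have [N_ [Nl yN]] : exists N_ : nat -> nat,
    (N_ m)%:R / (n_ m)%:R @[m --> \oo] --> l /\
    forall m, y * (N_ m)%:R <= (d_ m)%:R.
  have [yE|yne] := eqVneq y 0.
    exists (fun m => Num.truncn (l * (n_ m)%:R)); split; last first.
      by move=> m; rewrite yE mul0r.
    apply: cvg_truncn_ratio => //.
      by move=> m; rewrite mulr_ge0 // ltW.
    apply: cvg_near_cst; near=> m; rewrite mulfK // gt_eqF //.
    by near: m.
  have ygt0 : 0 < y by rewrite lt_def yne.
  exists (fun m => Num.truncn ((d_ m)%:R / y)); split; last first.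
    move=> m; rewrite mulrC -ler_pdivlMr // truncn_le.
    by rewrite divr_ge0.
  apply: cvg_truncn_ratio => //; first by move=> m; rewrite divr_ge0.
  have -> : l = y^-1 * Delta.
    by rewrite /y invfM invrK mulrAC mulVf ?mul1r //;
      apply: contraNneq yne => D0; rewrite /y D0 mul0r.
  under eq_fun do rewrite mulrAC mulrC.
  exact: cvgMr.
have Noo := ratio_cvg_infty l0 n_to_oo Nl.
(* The absolute value of [dim_LRC_le] divided by [n_ m]; it tends to 0 as [N_ m / n_ m] tends to
   [l]. *)
pose E m : R := `|l + nu * kappa%:R * (n_ m)%:R^-1 - (N_ m)%:R / (n_ m)%:R|.
pose B m : R := x + E m + kopt_rate kopt y (N_ m) * ((N_ m)%:R / (n_ m)%:R).
have Bl : B m @[m --> \oo] --> x + l * Ropt kopt y.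
  rewrite -[x]addr0 [l * _]mulrC.
  apply: cvgD.
    apply: cvgD; first exact: cvg_cst.
    rewrite -[X in _ --> X](@normr0 _ R).
    apply: cvg_norm; rewrite -(subrr l); apply: cvgB => //.
    rewrite -[X in _ --> X]addr0; apply: cvgD; first exact: cvg_cst.
    by rewrite -[X in _ --> X](mulr0 (nu * kappa%:R)); apply: cvgMr.
  apply: cvgM => //.
  by apply: (cvg_comp _ _ Noo); apply: Ropt_exists.
have Bnear : \forall m \near \oo, B m <= x + l * Ropt kopt y + eps / 2.
  by apply: (cvgr_le _ Bl); rewrite ltrDl.
near=> m.
have n0 : 0 < (n_ m)%:R :> R by near: m.
have N0 : 0 < (N_ m)%:R :> R.
  by rewrite ltr0n; near: m; have /cvgnyPge/(_ 1%N) := Noo.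
apply: le_trans (_ : B m <= _); last first.
  apply: le_trans (_ : x + l * Ropt kopt y + eps / 2 <= _).
    by near: m.
  by move: xinf; lra.
have [dk [Cd _] loc] := LRC_C m.
(* [d_ m] is an integer, so [y * N_ m <= d_ m] survives rounding up. *)
have ceil_d : (absz (Num.ceil (y * (N_ m)%:R)) <= d_ m)%N.
  rewrite -lez_nat gez0_abs ?ceil_le_int -?pmulrn //.
  by rewrite ceil_ge0 (lt_le_trans (ltrN10 R)) // mulr_ge0.
have := dim_LRC_le koptP (N_ m) loc kappaP Cd x0 ceil_d.
rewrite dk -/nu -/l ler_pdivrMr // => /le_trans; apply.
rewrite /B /kopt_rate !mulrDl lerD //; last first.
  by rewrite mulrA !divfK ?gt_eqF.
rewrite lerD // /E -[X in _ <= _ * X]gtr0_norm // -normrM.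
rewrite le_eqVlt; apply/orP; left; apply/eqP; congr (`|_|).
by field; rewrite gt_eqF.
Unshelve. all: by end_near. Qed.
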